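(* Let $d$ be a positive integer. Let $\mu_1,\ldots,\mu_d$ be finite absolutely continuous measures on $A_{d-1}(\mathbb{R}^d)$. Then at least one of the following holds: (i) there exists a unit vector $v\perp e_d$ such that all of $\mu_1,\ldots,\mu_d$ have the same median speed in the direction $v$; or (ii) there exist a translate $\ell$ of the line $\operatorname{span}(e_d)$ and a point of $\ell$ that splits $\ell$ into two complementary closed half-lines $A,B$ such that \[ \mu_i^{\ell}(A)=\mu_i^{\ell}(B)\qquad\text{for each } i=1,\ldots,d. \]
   Context: $A_{d-1}(\mathbb{R}^d)$ is the space of affine hyperplanes of $\mathbb{R}^d$, and $e_d$ is the last canonical basis vector. Via the natural embedding $A_{d-1}(\mathbb{R}^d)\hookrightarrow G_d(\mathbb{R}^{d+1})$ (sending $H$ to the linear span of $H\times\{1\}$) into the Grassmannian of $d$-dimensional linear subspaces of $\mathbb{R}^{d+1}$, which is a $d$-dimensional projective space, $A_{d-1}(\mathbb{R}^d)$ inherits a measure from the rotation-invariant measure on the double cover $S^d$ of $G_d(\mathbb{R}^{d+1})$. A measure on $A_{d-1}(\mathbb{R}^d)$ is absolutely continuous if it is absolutely continuous with respect to this measure. For such a measure, the set of hyperplanes whose normal vectors are orthogonal to $e_d$ has measure zero. Given an absolutely continuous measure $\mu$ on $A_{d-1}(\mathbb{R}^d)$ and a line $\ell\subset\mathbb{R}^d$, define a measure on $\ell$ by $\mu^\ell(C)=\mu\{H\in A_{d-1}(\mathbb{R}^d): H\cap\ell\text{ is a point and } H\cap\ell\in C\}$ for measurable $C\subset\ell$. For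 a hyperplane $H$ with normal vector $n$ satisfying $\langle n,e_d\rangle\ne0$ and a unit vector $v\perp e_d$, the vertical speed of $H$ in direction $v$ is $m(H,v)=-\langle n,v\rangle/\langle n,e_d\rangle$. The median speed (also called median vertical speed) of $\mu$ in the direction $v$ is the number $m$ such that $\mu\{H\in A_{d-1}(\mathbb{R}^d): m(H,v)\le m\}=\mu\{H\in A_{d-1}(\mathbb{R}^d): m(H,v)\ge m\}$. That all measures have the same median speed in the direction $v$ means that one common value $m$ satisfies this equality for every one of the measures. *)

(* Defs.v *)
From HB Require Import structures.
From mathcomp Require Import all_boot all_order all_algebra.
From mathcomp Require Import all_classical all_reals all_analysis.
Set Implicit Arguments.
Unset Strict Implicit.
Unset Printing Implicit Defensive.
Import Order.TTheory GRing.Theory Num.Theory.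
Import numFieldNormedType.Exports.
Local Open Scope classical_set_scope.
Local Open Scope ring_scope.

Section euclidean.
Context {R : realType} {d : nat}.

(* The library norm on 'rV[R]_d is the sup norm, so Euclidean notions are
   expressed through this inner product. *)
Definition dotv (u v : 'rV[R]_d) : R := \sum_i u 0 i * v 0 i.

Definition unit_vector (v : 'rV[R]_d) : Prop := dotv v v = 1.

Definition line (p w : 'rV[R]_d) : set 'rV[R]_d :=
  [set p + t *: w | t in [set: R]].

Definition half_line (p w : 'rV[R]_d) : set 'rV[R]_d :=
  [set p + t *: w | t in [set t : R | 0 <= t]].

Definition linear_span (A : set 'rV[R]_d) : set 'rV[R]_d :=
  [set y | forall U : {vspace 'rV[R]_d}, (forall x, A x -> x \in U) -> y \in U].

Definition orthogonal_complement (u : 'rV[R]_d) : set 'rV[R]_d :=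
  [set x | dotv u x = 0].

Definition is_normal (a : 'rV[R]_d) (H : set 'rV[R]_d) : Prop :=
  a != 0 /\ exists c : R, H = [set x | dotv a x = c].

Definition is_hyperplane (H : set 'rV[R]_d) : Prop := exists a, is_normal a H.

Lemma dotvC (u v : 'rV[R]_d) : dotv u v = dotv v u.
Proof. by apply: eq_bigr => i _; rewrite mulrC. Qed.

Lemma dotvD (u v w : 'rV[R]_d) : dotv u (v + w) = dotv u v + dotv u w.
Proof. by rewrite -big_split; apply: eq_bigr => i _; rewrite mxE mulrDr. Qed.

Lemma dotvZ (u v : 'rV[R]_d) (t : R) : dotv u (t *: v) = t * dotv u v.
Proof. by rewrite mulr_sumr; apply: eq_bigr => i _; rewrite mxE mulrCA. Qed.

Lemma dotvv_eq0 (u : 'rV[R]_d) : (dotv u u == 0) = (u == 0).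
Proof.
apply/eqP/eqP => [/eqP|->]; last by apply: big1 => i _; rewrite mxE mul0r.
rewrite psumr_eq0 => [/allP u0|i _]; last by rewrite -expr2 sqr_ge0.
apply/rowP => i; rewrite mxE; apply/eqP.
by have := u0 i (mem_index_enum i); rewrite mulf_eq0 orbb.
Qed.

Lemma normal_parallel (a b : 'rV[R]_d) (H : set 'rV[R]_d) :
  is_normal a H -> is_normal b H -> exists2 t : R, t != 0 & b = t *: a.
Proof.
move=> [a0 [c Ha]] [b0 [c' Hb]].
have aa0 : dotv a a != 0 by rewrite dotvv_eq0.
pose p := (c / dotv a a) *: a.
have ap : dotv a p = c by rewrite dotvZ divfK.
have bp : dotv b p = c'.
  by have : H p by [rewrite Ha]; rewrite Hb.
have bperp w : dotv a w = 0 -> dotv b w = 0.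
  move=> aw0; have : H (p + w) by rewrite Ha /= dotvD aw0 addr0.
  by rewrite Hb /= dotvD bp => /eqP; rewrite -subr_eq0 addrAC subrr add0r => /eqP.
pose t := dotv a b / dotv a a.
pose w := b - t *: a.
have aw : dotv a w = 0.
  by rewrite /w dotvD -scaleNr dotvZ mulNr divfK// subrr.
have w0 : w = 0.
  apply/eqP; rewrite -dotvv_eq0 {2}/w dotvD -scaleNr dotvZ.
  by rewrite (dotvC w b) (bperp _ aw) (dotvC w a) aw mulr0 addr0.
have bE : b = t *: a by apply/eqP; rewrite -subr_eq0; apply/eqP.
exists t => //; apply: contra_neq b0 => t0.
by rewrite bE t0 scale0r.
Qed.

End euclidean.

Section sphere.
Variables (R : realType) (d : nat).

Definition sphere : Type :=
  set_type [set u : 'rV[R]_(d + 1) | unit_vector u].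

HB.instance Definition _ := Topological.on sphere.

Lemma sphere_nonempty :
  (row_mx 0 1%:M : 'rV[R]_(d + 1)) \in [set u : 'rV[R]_(d + 1) | unit_vector u].
Proof.
rewrite inE /= /unit_vector /dotv big_split_ord /= big1 ?add0r; last first.
  by move=> i _; rewrite row_mxEl mxE mul0r.
by rewrite big_ord1 row_mxEr mxE eqxx mulr1.
Qed.

HB.instance Definition _ := isPointed.Build sphere (exist (fun x => x \in _) _ sphere_nonempty).

Definition borel_sphere := g_sigma_algebraType (@open sphere).
HB.instance Definition _ := Measurable.on borel_sphere.

Definition rotation (Q : 'M[R]_(d + 1)) : Prop :=
  Q *m Q^T = 1%:M /\ \det Q = 1.

Definition rotate (Q : 'M[R]_(d + 1)) (A : set borel_sphere) :
    set borel_sphere :=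
  [set u | exists2 w, A w & \val u = \val w *m Q].

(* As rotations act transitively on the sphere for d >= 1, such a measure is
   unique up to a positive factor. *)
Definition rotation_invariant
    (sigma : {finite_measure set borel_sphere -> \bar R}) : Prop :=
  sigma [set: borel_sphere] != 0%E /\
  forall Q A, rotation Q -> measurable A -> sigma (rotate Q A) = sigma A.

End sphere.

(* The ambient space of the hyperplanes is R^d with d = n.+1. *)
Section hyperplanes.
Variables (R : realType) (n : nat).
Local Notation d := n.+1.

Definition hyperplane := {H : set 'rV[R]_d | is_hyperplane H}.

HB.instance Definition _ := gen_eqMixin hyperplane.
HB.instance Definition _ := gen_choiceMixin hyperplane.

Definition e_last : 'rV[R]_d := delta_mx 0 ord_max.

Lemma hyperplane_nonempty : is_hyperplane [set x | dotv e_last x = 0].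
Proof.
exists e_last; split; last by exists 0.
apply/eqP => /rowP /(_ ord_max) /eqP.
by rewrite !mxE !eqxx oner_eq0.
Qed.

HB.instance Definition _ :=
  isPointed.Build hyperplane (exist _ _ hyperplane_nonempty).

Definition embed (H : hyperplane) : set 'rV[R]_(d + 1) :=
  linear_span [set row_mx x 1%:M | x in sval H].

Lemma embed_hyperplane (H : hyperplane) (a : 'rV[R]_d) (c : R) :
  a != 0 -> sval H = [set x | dotv a x = c] ->
  embed H = orthogonal_complement (row_mx a (- c)%:M).
Proof.
move=> a0 HE.
have dotE (x : 'rV[R]_d) (t : 'M[R]_1) :
    dotv (row_mx a (- c)%:M) (row_mx x t) = dotv a x - c * t 0 0.
  rewrite /dotv big_split_ord /= big_ord1 !row_mxEr mxE eqxx mulr1n mulNr; congr (_ - _).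
  by apply: eq_bigr => i _; rewrite !row_mxEl.
have aa0 : dotv a a != 0 by rewrite dotvv_eq0.
apply/seteqP; split=> y.
- rewrite /embed /linear_span /= => /(_ (lker (linfun (mulmxr (row_mx a (- c)%:M)^T)))).
  have E z : (z \in lker (linfun (mulmxr (row_mx a (- c)%:M)^T))) = (dotv (row_mx a (- c)%:M) z == 0).
    have D : z *m (row_mx a (- c)%:M)^T = (dotv (row_mx a (- c)%:M) z)%:M.
      apply/matrixP => i j; rewrite !ord1 [LHS]mxE [RHS]mxE eqxx mulr1n dotvC.
      by apply: eq_bigr => k _; rewrite [(_^T) _ _]mxE.
    rewrite memv_ker lfunE /= D; apply/eqP/eqP => [/matrixP/(_ 0 0)|->].
      by rewrite [LHS]mxE [RHS]mxE eqxx mulr1n.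
    by apply/matrixP => i j; rewrite !mxE mul0rn.
  rewrite E => h; apply/eqP; apply: h => _ [x Hx <-].
  rewrite E dotE mxE eqxx mulr1n.
  by move: Hx; rewrite HE /= => ->; rewrite mulr1 subrr.
- rewrite /orthogonal_complement /= -(hsubmxK y) dotE.
  set x := lsubmx y; set t := rsubmx y => xt U UH.
  pose p := (c / dotv a a) *: a.
  have pU : row_mx p 1%:M \in U.
    by apply: UH; exists p => //; rewrite HE /= dotvZ divfK.
  have qU : row_mx (p + (x - t 0 0 *: p)) 1%:M \in U.
    apply: UH; exists (p + (x - t 0 0 *: p)) => //; rewrite HE /= !dotvD -scaleNr !dotvZ divfK//.
    move/eqP : xt; rewrite subr_eq0 => /eqP ->; by rewrite mulNr mulrC subrr addr0.
  have -> : row_mx x t = row_mx (p + (x - t 0 0 *: p)) 1%:M - row_mx p 1%:M + t 0 0 *: row_mx p 1%:M.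
    rewrite scale_row_mx opp_row_mx !add_row_mx; congr row_mx.
      by rewrite [p + _]addrC addrK subrK.
    by rewrite subrr add0r scalemx1 [LHS]mx11_scalar.
  by rewrite memvD ?memvZ// memvB.
Qed.
(* The double cover of the Grassmannian sends a point u of the sphere to the
   orthogonal complement of u. *)
Definition cover_preimage (P : set hyperplane) : set (borel_sphere R d) :=
  [set u | exists2 H, P H & embed H = orthogonal_complement (\val u)].

(* The image of [embed] is open in the Grassmannian, whose topology is the
   quotient topology of the double cover. *)
Definition hyperplane_open (P : set hyperplane) : Prop :=
  open (cover_preimage P : set (sphere R d)).

Definition borel_hyperplane := g_sigma_algebraType hyperplane_open.
HB.instance Definition _ := Measurable.on borel_hyperplane.

Definition inherited_measure
    (sigma : {finite_measure set (borel_sphere R d) -> \bar R}) :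
    set borel_hyperplane -> \bar R :=
  fun P => sigma (cover_preimage P).

Definition absolutely_continuous (mu : set borel_hyperplane -> \bar R) : Prop :=
  exists sigma, rotation_invariant sigma /\ mu `<< inherited_measure sigma.

Definition line_measure (mu : set borel_hyperplane -> \bar R)
    (l C : set 'rV[R]_d) : \bar R :=
  mu [set H | exists x, sval H `&` l = [set x] /\ C x].

Definition normal (H : hyperplane) : 'rV[R]_d := projT1 (cid (svalP H)).

Definition vertical_speed (H : hyperplane) (v : 'rV[R]_d) : R :=
  - (dotv (normal H) v / dotv (normal H) e_last).

Definition has_vertical_speed (H : hyperplane) : Prop :=
  dotv (normal H) e_last != 0.

Lemma vertical_speedE (H : hyperplane) (a v : 'rV[R]_d) :
  is_normal a (sval H) ->
  vertical_speed H v = - (dotv a v / dotv a e_last) /\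
  (has_vertical_speed H <-> dotv a e_last != 0).
Proof.
move=> /(normal_parallel (projT2 (cid (svalP H)))) [t t0 ->].
rewrite /vertical_speed /has_vertical_speed /normal.
set b := projT1 _.
rewrite ![dotv (t *: b) _]dotvC !dotvZ !(dotvC _ b) -mulf_div divff// mul1r.
by rewrite mulf_eq0 (negbTE t0).
Qed.

Definition is_median_speed (mu : set borel_hyperplane -> \bar R)
    (v : 'rV[R]_d) (m : R) : Prop :=
  mu [set H | has_vertical_speed H /\ vertical_speed H v <= m] =
  mu [set H | has_vertical_speed H /\ m <= vertical_speed H v].

End hyperplanes.

(* Main.v *)
(* Identify a non-vertical hyperplane H with a point of R^d. A point z of
   R^(d+1) \ {0} then defines a side of H, and g_i(z) = mu_i(positive side) -
   mu_i(negative side) is an odd function of z; it is continuous because absolutely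
   continuous measures do not charge the hyperplanes in a great sphere. By
   Borsuk-Ulam the d functions g_i have a common zero (x, t, s): if s <> 0 it is
   the point sought in (ii), if s = 0 and x <> 0 it yields the direction in (i),
   and otherwise all the masses vanish.

   Borsuk-Ulam is proved with cochains mod 2. If s_1, ..., s_n are odd sign
   functions, the cochains a_k = ds_1 u ... u ds_k u s_(k+1) satisfy
   d a_k = a_(k+1) + T a_(k+1), T being the antipodal map; dually, the hemispheres
   c_k of the cross-polytope satisfy bd c_(k+1) = c_k + T c_k, and barycentric
   subdivision preserves this. Hence ds_1 u ... u ds_n is 1 on every subdivision
   of c_n, so some small simplex v_0 ... v_n has s_j(v_(j-1)) <> s_j(v_j) for all j,
   and such simplices accumulate at a common zero.

   A great sphere is null for a rotation-invariant measure since infinitely many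
   of its rotated copies can be put in general position along the moment curve. *)

Require Import Defs.
From mathcomp Require Import all_boot all_order all_algebra.
From mathcomp Require Import all_classical all_reals all_analysis.
From mathcomp Require Import measurable_realfun.
From mathcomp Require Import ring lra.
Set Implicit Arguments.
Unset Strict Implicit.
Unset Printing Implicit Defensive.
Import Order.TTheory GRing.Theory Num.Theory.
Import numFieldNormedType.Exports.
Local Open Scope classical_set_scope.
Local Open Scope ring_scope.

(** * The Borsuk-Ulam theorem *)

Section chains.
Variables (R : realType) (V : normedModType R).
Implicit Types (s t u : seq V) (C : seq (seq V)) (a : seq V -> bool).

(* A chain mod 2 is a list of simplices, each a list of vertices, and a cochain
   is a boolean function on simplices; [ev] is their pairing. The empty list is
   the simplex of dimension -1. *)
Fixpoint faces t : seq (seq V) :=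
  if t is x :: t' then t' :: map (cons x) (faces t') else [::].

Definition ev a C : bool := \big[addb/false]_(t <- C) a t.

Definition cobd a t : bool := ev a (faces t).

Lemma cobd_cons a x t : cobd a (x :: t) = a t (+) cobd (a \o cons x) t.
Proof. by rewrite /cobd /ev /= big_cons big_map. Qed.

Lemma ev_add a b C : ev a C (+) ev b C = ev (fun t => a t (+) b t) C.
Proof. by rewrite /ev big_split. Qed.

(** By dropping [x] before or after another vertex, [cobd a t] arises twice and cancels mod 2; the
    rest is the same sum for [a \o cons x]. *)
Lemma cobd_cobd a t : cobd (cobd a) t = false.
Proof.
elim: t a => [|x t IH] a; first by rewrite /cobd /ev big_nil.
rewrite cobd_cons /cobd /ev /=.
under [X in _ (+) X]eq_bigr do rewrite /= big_cons big_map.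
rewrite big_split /= addbA addbb addFb.
exact: (IH (a \o cons x)).
Qed.

Lemma size_faces t u : u \in faces t -> size u = (size t).-1.
Proof.
elim: t u => [//|x t IH] u; rewrite inE => /predU1P[->//|/mapP[w wt ->]] /=.
by rewrite (IH _ wt); case: t wt {IH}.
Qed.

Lemma mem_faces t u x : u \in faces t -> x \in u -> x \in t.
Proof.
elim: t u => [//|y t IH] u /=; rewrite inE => /predU1P[->|/mapP[w wt ->]].
  by rewrite inE => ->; rewrite orbT.
by rewrite !inE => /predU1P[->|/(IH _ wt) ->]; rewrite ?eqxx ?orbT.
Qed.

Lemma faces_opp t : faces (map -%R t) = map (map -%R) (faces t).
Proof.
elim: t => [//|x t IH] /=; rewrite IH -!map_comp; congr cons.
Qed.

Implicit Types (f : V -> bool) (ss : seq (V -> bool)).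

(* The cup product of the coboundaries of all functions of the list but the
   last with the last one, as a 0-cochain; its degree is [(size ss).-1]. *)
Fixpoint cup ss t : bool :=
  match ss, t with
  | [::], [::] => true
  | f :: ss', x :: t' =>
      (if t' is y :: _ then f x (+) f y else f x) && cup ss' t'
  | _, _ => false
  end.

(** Leibniz rule: each factor but the last is a coboundary, so only the last one is differentiated,
    and appending the constant does just that. *)
Lemma cobd_cup ss t : cobd (cup ss) t = cup (rcons ss xpredT) t.
Proof.
elim: ss t => [|f ss IH] [|x [|y t]].
- by rewrite /cobd /ev big_nil.
- by rewrite /cobd /ev big_seq1.
- rewrite cobd_cons /= /cobd /ev /= big1_seq// => -[|? ?]//.
- by rewrite /cobd /ev big_nil.
- by rewrite /cobd /ev big_seq1 /=; case: ss {IH} => [|? ?] /=; rewrite andbF.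
rewrite !cobd_cons [RHS]/= -IH cobd_cons /cobd /ev.
case: t => [|z t].
  rewrite /= !big_nil !addbF /=.
  by case: (f x); case: (f y) => /=; rewrite ?addbF ?addFb ?addbb//; case: cup.
(* The faces that keep [x] and [y] share the factor [f x (+) f y]. *)
under [in LHS]eq_bigr do rewrite /=.
rewrite -big_distrr /=.
by case: (f x); case: (f y); case: (f z); rewrite /= ?addbF ?addFb ?addbA ?addbb.
Qed.

(* [f] and its composite with the antipodal map sum to the constant 1. *)
Lemma cup_opp ss f t :
  {in f :: ss & t, forall g x, g (- x) = ~~ g x} ->
  cup (rcons ss f) t (+) cup (rcons ss f) (map -%R t) =
  cup (rcons ss xpredT) t.
Proof.
elim: ss t => [|g ss IH] [|x t] odd_ss //.
  case: t odd_ss => [|y t] odd_ss /=; last by rewrite !andbF.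
  by rewrite odd_ss ?inE ?eqxx// !andbT addbN addbb.
have {}IH : cup (rcons ss f) t (+) cup (rcons ss f) (map -%R t) =
    cup (rcons ss xpredT) t.
  by apply: IH => h y hin yt; apply: odd_ss; rewrite !inE ?yt ?orbT//;
    move: hin; rewrite inE => /orP[->|->]; rewrite ?orbT.
rewrite /= -IH; case: t odd_ss {IH} => [|y t] odd_ss /=.
  by case: ss {odd_ss} => [|? ?]; rewrite /= !andbF.
(* Negating both values leaves [g x (+) g y] unchanged, so only the last factor feels the antipodal
   map. *)
rewrite !odd_ss ?inE ?eqxx ?orbT//.
by case: (g x); case: (g y).
Qed.

Definition bary s : V := (size s)%:R^-1 *: \sum_(x <- s) x.

(* Barycentric subdivision; the first argument bounds the recursion and is
   meant to be the size of the simplex. *)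
Fixpoint subd k s : seq (seq V) :=
  if k is k'.+1 then
    flatten [seq map (cons (bary s)) (subd k' u) | u <- faces s]
  else [:: [::]].

Definition subdivide C := flatten [seq subd (size s) s | s <- C].

(** The transpose of subdivision: subdividing a chain amounts to pulling back the cochain. *)
Definition pull a s := ev a (subd (size s) s).

Lemma ev_flatten (T : Type) a (F : T -> seq (seq V)) (r : seq T) :
  ev a (flatten (map F r)) = \big[addb/false]_(x <- r) ev a (F x).
Proof.
elim: r => [|x r IH]; first by rewrite /ev !big_nil.
by rewrite /= /ev big_cat big_cons -IH.
Qed.

Lemma ev_subdivide a C : ev a (subdivide C) = ev (pull a) C.
Proof. exact: ev_flatten. Qed.

(** Subdivision is a chain map: dropping the barycentre leaves the subdivided boundary, and the
    faces that keep it lie over the boundary of the boundary, which is zero. *)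
Lemma cobd_pull a s : cobd (pull a) s = pull (cobd a) s.
Proof.
rewrite /pull; move sk: (size s) => k; elim: k s sk a => [|k IH] s sk a.
  by move/size0nil: sk => ->; rewrite /ev /= big_seq1 /cobd /ev !big_nil.
rewrite /= ev_flatten.
under eq_bigr => u _.
  rewrite /ev big_map.
  under eq_bigr do rewrite cobd_cons.
  rewrite big_split /=.
  over.
rewrite big_split /=.
rewrite [X in _ = _ (+) X](_ : _ = false).
  rewrite addbF; apply: eq_big_seq => u /size_faces.
  by rewrite sk /= => ->.
transitivity (cobd (cobd (pull (a \o cons (bary s)))) s); last exact: cobd_cobd.
apply: eq_big_seq => u us.
have uk : size u = k by rewrite (size_faces us) sk.
rewrite -[LHS]/(ev (cobd (a \o cons (bary s))) (subd k u)).
by rewrite -(IH u uk).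
Qed.

Lemma ev_cobd_subdivide a C m :
  ev (cobd a) (iter m subdivide C) = ev (cobd (iter m pull a)) C.
Proof.
elim: m C => [//|m IH] C; rewrite iterSr IH ev_subdivide /=.
by apply: eq_bigr => s _; rewrite -cobd_pull.
Qed.

Lemma ev_iter_subdivide a C m : ev a (iter m subdivide C) = ev (iter m pull a) C.
Proof.
elim: m C => [//|m IH] C; rewrite iterSr IH ev_subdivide /=.
by [].
Qed.

Lemma bary_opp s : bary (map -%R s) = - bary s.
Proof. by rewrite /bary size_map big_map sumrN scalerN. Qed.

Lemma subd_opp k s : subd k (map -%R s) = map (map -%R) (subd k s).
Proof.
elim: k s => [//|k IH] s /=.
rewrite faces_opp map_flatten -!map_comp; congr flatten.
apply: eq_map => u /=; rewrite IH bary_opp -!map_comp.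
by apply: eq_map.
Qed.

Lemma pull_opp a s : pull a (map -%R s) = pull (a \o map -%R) s.
Proof. by rewrite /pull size_map subd_opp /ev big_map. Qed.

Lemma iter_pull_opp a s m :
  iter m pull a (map -%R s) = iter m pull (a \o map -%R) s.
Proof.
elim: m s => [//|m IH] s; rewrite !iterS pull_opp.
by apply: eq_bigr => t _ /=; rewrite IH.
Qed.

Lemma mem_subd (P : V -> Prop) k s t :
  (forall u, u != [::] -> {in u, forall x, P x} -> P (bary u)) ->
  size s = k -> {in s, forall x, P x} -> t \in subd k s ->
  size t = k /\ {in t, forall x, P x}.
Proof.
move=> Pbary; elim: k s t => [|k IH] s t sk Ps; first by rewrite inE => /eqP ->.
move=> /flattenP[_ /mapP[u us ->] /mapP[w wu ->]].
have [//||wk Pw] := IH u w _ _ wu; first by rewrite (size_faces us) sk.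
  by move=> x xu; apply: Ps; apply: mem_faces us xu.
split; first by rewrite /= wk.
move=> x; rewrite inE => /predU1P[->|]; last exact: Pw.
by apply: Pbary => //; rewrite -size_eq0 sk.
Qed.

Lemma bary_sub s c : s != [::] ->
  bary s - c = (size s)%:R^-1 *: \sum_(x <- s) (x - c).
Proof.
rewrite -size_eq0 => s0.
rewrite sumrB scalerBr big_const_seq count_predT iter_addr_0 -[c *+ _]scaler_nat.
by rewrite scalerA mulVf ?pnatr_eq0// scale1r.
Qed.

Lemma bary_ball (c : V) r s : s != [::] -> {in s, forall x, `|x - c| <= r} ->
  `|bary s - c| <= r.
Proof.
move=> s0 sr.
have s0' : 0 < (size s)%:R :> R by rewrite ltr0n lt0n size_eq0.
rewrite bary_sub// normrZ ger0_norm ?invr_ge0 ?ler0n// ler_pdivrMl//.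
rewrite (le_trans (ler_norm_sum _ _ _))//.
rewrite mulr_natl -(iter_addr_0 (size s)) -count_predT -big_const_seq.
by rewrite big_seq [leRHS]big_seq; apply: ler_sum => x /sr.
Qed.

(** The vertex [x] contributes 0 to the average of the differences, so only [(size s).-1] of the
    [size s] terms count. *)
Lemma bary_diam (r : R) k s x : (size s <= k.+1)%N -> 0 <= r ->
  {in s &, forall y z, `|y - z| <= r} -> x \in s ->
  `|x - bary s| <= k%:R / k.+1%:R * r.
Proof.
move=> sk r0 sr xs.
have s0 : (0 < size s)%N by case: s xs {sr sk}.
have s0' : 0 < (size s)%:R :> R by rewrite ltr0n.
rewrite distrC bary_sub -?size_eq0 -?lt0n// normrZ ger0_norm ?invr_ge0 ?ler0n//.
apply: (@le_trans _ _ ((size s)%:R^-1 * ((size s).-1%:R * r))).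
  rewrite ler_pM2l ?invr_gt0// (le_trans (ler_norm_sum _ _ _))//.
  rewrite (big_rem x)//= subrr normr0 add0r.
  rewrite mulr_natl -(size_rem xs) -(iter_addr_0 (size _)) -count_predT.
  rewrite -big_const_seq big_seq [leRHS]big_seq; apply: ler_sum => y /mem_rem ys.
  exact: sr.
rewrite mulrA ler_wpM2r// mulrC ler_pdivrMr// mulrAC ler_pdivlMr ?ltr0n//.
rewrite -!natrM ler_nat; case: (size s) s0 sk => // j _ /= jk.
by rewrite !mulnS (mulnC k) leq_add2r.
Qed.

(** Two new vertices either include the barycentre of [s] or come from a proper face; a single bound
    [k] serves all faces, so the contraction factor stays the same along the induction. *)
Lemma subd_diam (r : R) k s t : (size s <= k.+1)%N -> 0 <= r ->
  {in s &, forall y z, `|y - z| <= r} ->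
  t \in subd (size s) s ->
  {in t &, forall y z, `|y - z| <= k%:R / k.+1%:R * r}.
Proof.
move=> sk r0; move sj: (size s) => j.
elim: j s t sk sj => [|j IH] s t sk sj sr; first by rewrite inE => /eqP ->.
move=> /flattenP[_ /mapP[u us ->] /mapP[w wu ->]].
have uj : size u = j by rewrite (size_faces us) sj.
have wb x : x \in w -> `|x - bary s| <= k%:R / k.+1%:R * r.
  move: x; apply: (mem_subd _ uj _ wu).2 => [|x xu].
    by move=> v; apply: bary_ball.
  by apply: bary_diam => //; apply: mem_faces us xu.
have ww := IH u w _ uj _ wu.
move=> y z; rewrite !inE => /predU1P[->|yw] /predU1P[->|zw].
- by rewrite subrr normr0 mulr_ge0// divr_ge0.
- by rewrite distrC wb.
- by rewrite wb.
apply: ww => //; first by rewrite uj -ltnS ltnW// -sj.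
by move=> ? ? yu zu; apply: sr; apply: mem_faces us _.
Qed.

End chains.

(** * The cross-polytope, its hemispheres and the parity count on them *)

Section octahedron.
Variables (R : realType) (V : normedModType R) (e : nat -> V).
Implicit Types (s t : seq V) (C : seq (seq V)) (a : seq V -> bool).
Implicit Types (f : V -> bool) (ss : seq (V -> bool)).

(* The boundary of the cross-polytope spanned by [e 0], ..., [e k.-1]; its
   dimension is [k.-1]. *)
Fixpoint octahedron k : seq (seq V) :=
  if k is k'.+1 then
    map (cons (e k')) (octahedron k') ++ map (cons (- e k')) (octahedron k')
  else [:: [::]].

Definition hemisphere k : seq (seq V) := map (cons (e k)) (octahedron k).

Lemma ev_cat a C C' : ev a (C ++ C') = ev a C (+) ev a C'.
Proof. exact: big_cat. Qed.

Lemma ev_octahedron_opp a k :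
  ev (a \o map -%R) (octahedron k) = ev a (octahedron k).
Proof.
elim: k a => [|k IH] a; first by rewrite /ev !big_seq1.
rewrite /= !ev_cat /ev !big_map /= opprK addbC.
congr addb; [exact: (IH (a \o cons (e k)))|].
exact: (IH (a \o cons (- e k))).
Qed.

(** The equator is antipodally symmetric, so the lower cone over it is the antipode of the upper
    one. *)
Lemma ev_octahedronS a k :
  ev a (octahedron k.+1) = ev a (hemisphere k) (+) ev (a \o map -%R) (hemisphere k).
Proof.
rewrite /= ev_cat; congr addb.
by rewrite /ev !big_map -[LHS]/(ev (a \o cons (- e k)) _) -ev_octahedron_opp.
Qed.

Lemma ev_cobd_cons a x C :
  ev (cobd a) (map (cons x) C) = ev a C (+) ev (cobd (a \o cons x)) C.
Proof.
rewrite /ev big_map -big_split; apply: eq_bigr => t _; exact: cobd_cons.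
Qed.

(** Each of the two cones is bounded by the equator, which cancels. *)
Lemma ev_cobd_octahedron a k : ev (cobd a) (octahedron k) = false.
Proof.
elim: k a => [|k IH] a; first by rewrite /ev big_seq1 /cobd /ev big_nil.
rewrite /= ev_cat !ev_cobd_cons !IH.
by rewrite !addbF addbb.
Qed.

Lemma ev_cobd_hemisphere a k : ev (cobd a) (hemisphere k) = ev a (octahedron k).
Proof. by rewrite ev_cobd_cons ev_cobd_octahedron addbF. Qed.

Lemma mem_hemisphere k t : t \in hemisphere k -> t \in octahedron k.+1.
Proof. by move=> tk; rewrite mem_cat tk. Qed.

Lemma mem_iter_subdivide (I : nat -> seq V -> Prop) C m t :
  (forall i s u, I i s -> u \in subd (size s) s -> I i.+1 u) ->
  (forall s, s \in C -> I 0 s) -> t \in iter m (@subdivide R V) C -> I m t.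
Proof.
move=> IS I0; elim: m t => [|m IH] t; first exact: I0.
by rewrite iterS => /flattenP[_ /mapP[s /IH Is ->]]; apply: IS.
Qed.

Lemma iter_subdivideS m C C' :
  {subset C <= C'} -> {subset iter m (@subdivide R V) C <= iter m (@subdivide R V) C'}.
Proof.
move=> CC'; elim: m => [//|m IH] t; rewrite !iterS => /flattenP[w wC tw].
apply/flattenP; exists w => //; case/mapP: wC => s sC ->.
exact/map_f/IH.
Qed.

(** Each round trades the hemisphere for its boundary sphere, splits this into a hemisphere and its
    antipode, and uses oddness of the last function to drop it; the rounds end at the empty simplex,
    where the value is 1. Oddness is asked at vertices only, since no boolean function can satisfy
    it at 0. *)
Lemma ev_cup_hemisphere ss m :
  (forall k t, (k <= size ss)%N ->
    t \in iter m (@subdivide R V) (octahedron k) ->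
    {in ss & t, forall f x, f (- x) = ~~ f x}) ->
  ev (cup (rcons ss xpredT)) (iter m (@subdivide R V) (hemisphere (size ss))).
Proof.
(* Stokes: the coboundary on a hemisphere is the cochain on the boundary sphere, also after
   subdivision. *)
have evE ss' : ev (cup (rcons ss' xpredT)) (iter m (@subdivide R V) (hemisphere (size ss')))
    = ev (cup ss') (iter m (@subdivide R V) (octahedron (size ss'))).
  rewrite [RHS]ev_iter_subdivide -ev_cobd_hemisphere -ev_cobd_subdivide.
  by apply: eq_bigr => t _; rewrite cobd_cup.
rewrite evE.
elim/last_ind: ss => [|ss f IH] odd_ss.
  suff -> : iter m (@subdivide R V) [:: [::]] = [:: [::]] by rewrite /ev big_seq1.
  by elim: m {odd_ss evE} => [//|m IH]; rewrite iterS IH.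
rewrite size_rcons in odd_ss *.
rewrite ev_iter_subdivide ev_octahedronS.
rewrite [X in _ (+) X](_ : _ =
    ev (iter m (@pull R V) (cup (rcons ss f) \o map -%R)) (hemisphere (size ss)));
    last first.
  by apply: eq_bigr => t _; exact: iter_pull_opp.
rewrite -!ev_iter_subdivide ev_add.
(* [cup_opp] merges the values on the two hemispheres into the cup product with one function
   fewer. *)
rewrite (_ : ev _ _ = ev (cup (rcons ss xpredT)) (iter m (@subdivide R V) (hemisphere (size ss)))).
  rewrite evE; apply: IH => k t kss tk g x gss.
  apply: (odd_ss k t _ tk); first exact: leqW.
  by rewrite mem_rcons inE gss orbT.
apply: eq_big_seq => t tm; rewrite cup_opp// => g x gin xt.
apply: (odd_ss _ t (leqnn _)) => //; last by rewrite mem_rcons.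
by apply: iter_subdivideS tm => u; apply: mem_hemisphere.
Qed.

Lemma ev_exists a C : ev a C -> exists2 t, t \in C & a t.
Proof.
by rewrite /ev; case: (boolP (has a C)) => [/hasP//|/hasPn aC];
  rewrite big_seq big1// => t /aC/negbTE.
Qed.

(** The appended constant makes every function of [ss] a differentiated factor, compared at two
    consecutive vertices. *)
Lemma cup_sign_change ss t f : cup (rcons ss xpredT) t -> f \in ss ->
  exists x y, [/\ x \in t, y \in t & f x != f y].
Proof.
elim: ss t => [//|g ss IH] [|x t]//= /andP[xt tss].
rewrite inE => /predU1P[->|/(IH _ tss)[y [z [yt zt yz]]]]; last first.
  by exists y, z; split; rewrite // inE ?yt ?zt orbT.
case: t xt tss {IH} => [|y t] xy; first by case: ss.
exists x, y; rewrite !inE !eqxx orbT; split => //.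
by case: (g x) (g y) xy => [] [].
Qed.

End octahedron.

(** * Coordinates on the cross-polytope and the limit over finer subdivisions *)

Section borsuk_ulam.
Variables (R : realType) (m : nat).
Local Notation V := 'rV[R]_m.

Definition basis (j : nat) : V := \row_i (i == j :> nat)%:R.

Lemma rV_norm_le (x : V) (r : R) : 0 <= r -> (forall i, `|x 0 i| <= r) -> `|x| <= r.
Proof.
move=> r0 xr; rewrite /Num.norm /= mx_normrE; apply/bigmax_leP; split => // -[i j] _.
by rewrite ord1 /= xr.
Qed.

Lemma rV_norm_ge (x : V) i : `|x 0 i| <= `|x|.
Proof.
by rewrite [leRHS]/Num.norm /= mx_normrE; apply/bigmax_geP; right; exists (0, i).
Qed.

(* The face of the cross-polytope with sign pattern w lies on the hyperplane
   \sum_i (-1)^(w i) x_i = 1, so it misses the origin. *)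
Definition near_face (w : nat -> bool) (x : V) : Prop :=
  \sum_(i < m) (-1) ^+ w i * x 0 i = 1 /\ `|x| <= 1.

Lemma near_face_bary w s : s != [::] -> {in s, forall x, near_face w x} ->
  near_face w (bary s).
Proof.
move=> s0 sw; split; last first.
  rewrite -[bary s]subr0; apply: bary_ball => // x /sw[_].
  by rewrite subr0.
have s0' : (size s)%:R != 0 :> R by rewrite pnatr_eq0 size_eq0.
rewrite /bary; under eq_bigr do rewrite mxE mulrCA.
rewrite -mulr_sumr; apply: (mulfI s0'); rewrite mulVKf// mulr1.
under eq_bigr do rewrite summxE mulr_sumr.
rewrite exchange_big /= -sum1_size natr_sum big_seq [RHS]big_seq.
by apply: eq_bigr => x /sw[].
Qed.

(** A bound rather than mere nonvanishing, so that limits of such points stay away from 0. *)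
Lemma near_face_neq0 w x : near_face w x -> 1 <= m%:R * `|x|.
Proof.
move=> [xw _]; rewrite -[leLHS]xw mulr_natl -[X in _ *+ X]card_ord -sumr_const.
apply: ler_sum => i _; rewrite (le_trans (ler_norm _))// normrM normrX normrN1.
by rewrite expr1n mul1r rV_norm_ge.
Qed.

(** The vanishing coordinates leave the sign [w k] free, so that it can be set to the sign of the
    new vertex. *)
Lemma octahedron_face k t : (k <= m)%N -> t \in octahedron basis k ->
  size t = k /\ exists w, {in t, forall x, near_face w x /\
    forall i : 'I_m, (k <= i)%N -> x 0 i = 0}.
Proof.
elim: k t => [|k IH] t km.
  by rewrite inE => /eqP ->; split => //; exists xpredT.
suff main u (b : bool) : u \in octahedron basis k -> t = (-1) ^+ b *: basis k :: u ->
    size t = k.+1 /\ exists w, {in t, forall x, near_face w x /\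
      forall i : 'I_m, (k < i)%N -> x 0 i = 0}.
  rewrite mem_cat => /orP[] /mapP[u uk tE].
  - by apply: (main u false) => //; rewrite tE expr0 scale1r.
  - by apply: (main u true) => //; rewrite tE expr1 scaleN1r.
move=> /(IH _ (ltnW km))[uk [w uw]] {t}->; split; first by rewrite /= uk.
exists (fun i => if i == k then b else w i) => x; rewrite inE => /predU1P[->|xu].
  split; last first.
    by move=> i ki; rewrite !mxE gtn_eqF// mulr0.
  split.
    rewrite (bigD1 (Ordinal km))//= !mxE eqxx mulr1 big1 ?addr0.
      by rewrite -signr_addb addbb.
    move=> i; rewrite -val_eqE /= => /negbTE ik.
    by rewrite ik !mxE ik !mulr0.
  apply: rV_norm_le => // i; rewrite !mxE normrM normrX normrN1 expr1n mul1r.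
  by case: eqP => _; rewrite ?normr1 ?normr0.
have [[xw x1] xk] := uw _ xu; split; last by move=> i ki; rewrite xk// ltnW.
split => //; rewrite -[RHS]xw; apply: eq_bigr => i _.
by have [ik|//] := eqVneq (i : nat) k; rewrite xk ?ik ?leqnn// !mulr0.
Qed.

Lemma near_face_iter k i t : (k <= m)%N ->
  t \in iter i (@subdivide R V) (octahedron basis k) ->
  size t = k /\ exists w, {in t, forall x, near_face w x}.
Proof.
move=> km; apply: (mem_iter_subdivide
  (I := fun _ t => size t = k /\ exists w, {in t, forall x, near_face w x})).
  move=> _ s u [sk [w sw]] us; split.
    by rewrite -sk; exact: (mem_subd (P := xpredT) _ erefl _ us).1.
  exists w; apply: (mem_subd _ erefl sw us).2.
  exact: near_face_bary.
move=> s /(octahedron_face km)[sk [w sw]]; split => //.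
by exists w => x /sw[].
Qed.

Lemma diam_iter k i t : (k < m)%N ->
  t \in iter i (@subdivide R V) (octahedron basis k.+1) ->
  {in t &, forall x y, `|x - y| <= (k%:R / k.+1%:R) ^+ i * 2}.
Proof.
move=> km ti; suff [] : size t = k.+1 /\
  {in t &, forall x y, `|x - y| <= (k%:R / k.+1%:R) ^+ i * 2} by [].
apply: (mem_iter_subdivide (I := fun i t => size t = k.+1 /\
  {in t &, forall x y, `|x - y| <= (k%:R / k.+1%:R) ^+ i * 2})) ti.
  move=> j s u [sk sd] us; split.
    by rewrite -sk; exact: (mem_subd (P := xpredT) _ erefl _ us).1.
  rewrite exprS -mulrA; apply: subd_diam us => //; first by rewrite sk.
move=> s /(octahedron_face km)[sk [w sw]]; split => // x y /sw[[_ x1] _] /sw[[_ y1] _].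
by rewrite expr0 mul1r (le_trans (ler_normB _ _))// lerD.
Qed.

Definition leading_sign (x : V) : bool :=
  if [pick i | x 0 i != 0] is Some i then 0 < x 0 i else true.

Lemma leading_signN x : x != 0 -> leading_sign (- x) = ~~ leading_sign x.
Proof.
move=> x0; rewrite /leading_sign.
under eq_pick do rewrite mxE oppr_eq0.
case: pickP => [i xi|/(_ _)/negbFE/eqP x_0].
  by rewrite mxE oppr_gt0 -leNgt le_eqVlt (negbTE xi).
by case/eqP: x0; apply/rowP => i; rewrite x_0 mxE.
Qed.

(* [leading_sign] breaks the ties where [g] vanishes in an odd way. *)
Definition sign_of (g : V -> R) (x : V) : bool :=
  (0 < g x) || ((g x == 0) && leading_sign x).

Lemma sign_ofN g x : g (- x) = - g x -> x != 0 ->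
  sign_of g (- x) = ~~ sign_of g x.
Proof.
move=> gx x0; rewrite /sign_of gx oppr_gt0 oppr_eq0 leading_signN//.
by case: ltgtP; rewrite ?andbF.
Qed.

(** Continuity is asked off the origin because the maps of interest are constant on rays and may
    jump at 0. *)
Theorem borsuk_ulam k (G : 'I_k -> V -> R) : (k < m)%N ->
  (forall i x, G i (- x) = - G i x) ->
  (forall i x, x != 0 -> {for x, continuous (G i)}) ->
  exists2 x, x != 0 & forall i, G i x = 0.
Proof.
move=> km Godd Gc.
pose ss := [seq sign_of (G i) | i <- enum 'I_k].
have ssk : size ss = k by rewrite size_map size_enum_ord.
(* At each level, a simplex on which every sign function takes both values. *)
have [t tP] : {t : nat -> seq V & forall i,
    t i \in iter i (@subdivide R V) (hemisphere basis k) /\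
    cup (rcons ss xpredT) (t i)}.
  apply: (@choice _ _ (fun i u =>
    u \in iter i (@subdivide R V) (hemisphere basis k) /\
    cup (rcons ss xpredT) u)) => i.
  have [|u ui us] := ev_exists (a := cup (rcons ss xpredT))
      (C := iter i (@subdivide R V) (hemisphere basis k)).
    rewrite -[X in hemisphere _ X]ssk; apply: ev_cup_hemisphere => j u jk uj _ x /mapP[l _ ->] xu.
    have [|_ [w uw]] := near_face_iter _ uj.
      by rewrite (leq_trans jk)// ssk ltnW.
    apply: sign_ofN => //; apply/eqP => x0.
    by have := near_face_neq0 (uw _ xu); rewrite x0 normr0 mulr0 ler10.
  by exists u.
have tk i : t i \in iter i (@subdivide R V) (octahedron basis k.+1).
  by apply: iter_subdivideS (tP i).1 => u; apply: mem_hemisphere.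
(* This compact shell contains all vertices and not the origin. *)
pose K := [set x : V | `|x| <= 1 /\ 1 <= m%:R * `|x|].
have Kt i x : x \in t i -> K x.
  have [_ [w tw]] := near_face_iter km (tk i).
  by move=> /tw xw; split; [exact: xw.2|exact: near_face_neq0 xw].
have t_head i : head 0 (t i) \in t i.
  have [ti _] := near_face_iter km (tk i).
  by case: (t i) ti => [//|x u] _; exact: mem_head.
have Kcompact : compact K.
  apply: bounded_closed_compact.
    by exists 1; split => // M M1 x [x1 _]; apply: le_trans x1 (ltW M1).
  rewrite (_ : K = (Num.norm @^-1` [set r : R | r <= 1]) `&`
      ((fun x : V => m%:R * `|x|) @^-1` [set r : R | 1 <= r])); last first.
    by apply/seteqP; split.
  apply: closedI; apply: closed_comp.
  - by move=> x _; exact: norm_continuous.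
  - exact: closed_le.
  - move=> x _; exact: (@cvgM R _ _ _ (fun=> m%:R) (fun y : V => `|y|) m%:R `|x|
      (cvg_cst _) (@norm_continuous _ _ x)).
  - exact: closed_ge.
(* A cluster point of the first vertices is the zero sought: otherwise some sign function would be
   constant near it, hence on a small simplex. *)
have [|z [[_ Kz] zt]] := Kcompact ((fun i => head 0 (t i)) @ \oo) _.
  by exists 0%N => // i _; exact: (Kt i _ (t_head i)).
have z0 : z != 0.
  by apply/eqP => z0; move: Kz; rewrite z0 normr0 mulr0 ler10.
exists z => // i; apply: contrapT => /eqP Gz.
have [eps eps0 epsP] : exists2 eps : R, 0 < eps &
    forall x, `|z - x| < eps -> sign_of (G i) x = (0 < G i z).
  have Gz0 : 0 < `|G i z| by rewrite normr_gt0.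
  have /nbhs_ballP[eps /= eps0 epsP] : \forall x \near z, `|G i z - G i x| < `|G i z|.
    by have /cvgrPdist_lt := Gc i z z0; apply.
  exists eps => // x zx; have {epsP} := epsP x.
  rewrite -ball_normE /= => /(_ zx); rewrite /sign_of.
  have [Gz1|Gz1] := ltP 0 (G i z).
    rewrite (gtr0_norm Gz1) ltr_norml => /andP[_ Gx].
    by have -> : 0 < G i x by lra.
  have {}Gz1 : G i z < 0 by rewrite lt_neqAle Gz.
  rewrite (ltr0_norm Gz1) ltr_norml => /andP[Gx _].
  have Gx0 : G i x < 0 by lra.
  by rewrite lt_eqF// ltNge ltW.
have q_lt1 : `|k%:R / k.+1%:R : R| < 1.
  by rewrite ger0_norm ?divr_ge0// ltr_pdivrMr ?ltr0n// mul1r ltr_nat.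
have q0 : ((k%:R / k.+1%:R) ^+ n * 2 : R) @[n --> \oo] --> (0 : R).
  rewrite -[X in _ --> X](mul0r 2).
  by apply: cvgM; [exact: cvg_expr|exact: cvg_cst].
have eps2 : 0 < eps / 2 by rewrite divr_gt0.
have /cvgrPdist_lt/(_ _ eps2)[M _ MP] := q0.
have [|_ [[j Mj <-]]] := zt ((fun j => head 0 (t j)) @` [set j | (M <= j)%N])
    (ball z (eps / 2)) _ (nbhsx_ballx _ _ eps2).
  by exists M => // j Mj; exists j.
rewrite -ball_normE /= => zj.
(* Half of [eps] covers the distance from [z] to the first vertex, half the diameter of the
   simplex. *)
have tz x : x \in t j -> sign_of (G i) x = (0 < G i z).
  move=> xt; apply: epsP.
  rewrite -(subrK (head 0 (t j)) z) -addrA (le_lt_trans (ler_normD _ _))//.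
  rewrite [ltRHS]splitr ltrD//.
  rewrite (le_lt_trans (diam_iter km (tk j) (t_head j) xt))//.
  have := MP j Mj; rewrite /= sub0r normrN ger0_norm//.
have [|x [y [xt yt]]] := cup_sign_change (f := sign_of (G i)) (tP j).2.
  by apply/mapP; exists i; rewrite ?mem_enum.
by rewrite !tz// eqxx.
Qed.

End borsuk_ulam.

(** * Great spheres are null for rotation-invariant measures *)

Section reflections.
Variables (R : realType) (d : nat).
Implicit Types (a b x : 'rV[R]_d) (P : 'M[R]_d).

Lemma dotvE a b : a *m b^T = (dotv a b)%:M.
Proof.
apply/matrixP => i j; rewrite !ord1 !mxE eqxx mulr1n.
by apply: eq_bigr => k _; rewrite mxE.
Qed.

Lemma dotvN a b : dotv a (- b) = - dotv a b.
Proof. by rewrite -scaleN1r dotvZ mulN1r. Qed.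

Lemma dotvZl a b (t : R) : dotv (t *: a) b = t * dotv a b.
Proof. by rewrite dotvC dotvZ dotvC. Qed.

Lemma dotv_orthogonal P a b : P *m P^T = 1%:M -> dotv (a *m P) (b *m P) = dotv a b.
Proof.
move=> PP; have := dotvE (a *m P) (b *m P).
rewrite trmx_mul mulmxA -(mulmxA a) PP mulmx1 dotvE.
by move=> /matrixP/(_ 0 0); rewrite !mxE eqxx !mulr1n.
Qed.

Lemma dotvv_gt0 a : a != 0 -> 0 < dotv a a.
Proof.
by move=> a0; rewrite lt0r dotvv_eq0 a0 sumr_ge0// => i _; rewrite -expr2 sqr_ge0.
Qed.

(** The Householder reflection in the hyperplane orthogonal to [a], acting on row vectors from the
    right; it is the identity for [a = 0]. *)
Definition reflection a : 'M[R]_d := 1%:M - (2 / dotv a a) *: (a^T *m a).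

Lemma mul_reflection x a :
  x *m reflection a = x - (2 * dotv x a / dotv a a) *: a.
Proof.
rewrite mulmxBr mulmx1 -scalemxAr mulmxA dotvE mul_scalar_mx scalerA.
by rewrite mulrAC.
Qed.

Lemma reflection_tr a : (reflection a)^T = reflection a.
Proof. by rewrite linearB linearZ /= trmx1 trmx_mul trmxK. Qed.

Lemma reflectionK a : a != 0 -> reflection a *m (reflection a)^T = 1%:M.
Proof.
rewrite -dotvv_eq0 reflection_tr => aa0.
apply/row_matrixP => i; rewrite -[X in X *m _]mul1mx !row_mul.
set x := row i _; rewrite mul_reflection mul_reflection (dotvC (x - _)).
rewrite dotvD -scaleNr dotvZ (dotvC a).
rewrite scaleNr -addrA -opprD -scalerDl [X in X *: _](_ : _ = 0) ?scale0r ?subr0//.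
by field.
Qed.

Lemma reflectionZ (t : R) a : t != 0 -> reflection (t *: a) = reflection a.
Proof.
move=> t0; rewrite /reflection dotvZ dotvZl [(t *: a)^T]linearZ /= -scalemxAr -scalemxAl !scalerA.
congr (_ - _ *: _); have [->|aa0] := eqVneq (dotv a a) 0.
  by rewrite !mulr0 !invr0 !(mulr0, mul0r).
by field; rewrite aa0.
Qed.

Lemma reflection_swap a b : dotv a a = dotv b b -> a != b ->
  a *m reflection (a - b) = b.
Proof.
move=> ab; rewrite -subr_eq0 -dotvv_eq0 => ab0; rewrite mul_reflection.
suff -> : 2 * dotv a (a - b) / dotv (a - b) (a - b) = 1.
  by rewrite scale1r opprB addrC subrK.
suff E : dotv (a - b) (a - b) = 2 * dotv a (a - b) by rewrite -E divff.
rewrite [LHS]dotvD dotvN !(dotvC (a - b)) !dotvD !dotvN (dotvC b a) -ab; ring.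
Qed.

Lemma reflection_conj P a : P *m P^T = 1%:M ->
  reflection (a *m P) = P^T *m reflection a *m P.
Proof.
move=> PP; rewrite /reflection dotv_orthogonal// mulmxBr mulmxBl mulmx1.
by rewrite (mulmx1C PP) -scalemxAr -scalemxAl trmx_mul !mulmxA.
Qed.

(** Once [b] is rescaled to the length of [a], a third reflection swaps the two vectors and
    conjugates one reflection into the other. *)
Lemma det_reflection_eq a b : a != 0 -> b != 0 ->
  \det (reflection a) = \det (reflection b).
Proof.
move=> a0 b0.
have aa := dotvv_gt0 a0.
have bb := dotvv_gt0 b0.
pose c := Num.sqrt (dotv a a / dotv b b).
have c0 : c != 0 by rewrite gt_eqF// sqrtr_gt0 divr_gt0.
have [->|acb] := eqVneq a (c *: b); first by rewrite reflectionZ.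
have cb : dotv a a = dotv (c *: b) (c *: b).
  rewrite dotvZ dotvZl mulrA -expr2 sqr_sqrtr ?divfK ?gt_eqF//.
  by rewrite divr_ge0// ltW.
have ab0 : a - c *: b != 0 by rewrite subr_eq0.
rewrite -(reflectionZ b c0) -(reflection_swap cb acb).
rewrite reflection_conj ?reflectionK// !det_mulmx mulrAC -det_mulmx.
by rewrite (mulmx1C (reflectionK ab0)) det1 mul1r.
Qed.

End reflections.

(** * Rotating great spheres, and counting along the moment curve *)

Section great_spheres.
Variables (R : realType) (d : nat).
Implicit Types (a b z : 'rV[R]_(d + 1)).

(** Two reflections compose to a rotation: the first sends [a] to [- a], the second [- a] to the
    positive multiple of [b] of the same length. *)
Lemma rotation_onto a b : a != 0 -> b != 0 ->
  exists Q, rotation Q /\ exists2 c : R, c != 0 & a *m Q = c *: b.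
Proof.
move=> a0 b0.
have aa := dotvv_gt0 a0.
have bb := dotvv_gt0 b0.
pose c := Num.sqrt (dotv a a / dotv b b).
have c0 : c != 0 by rewrite gt_eqF// sqrtr_gt0 divr_gt0.
have cb : dotv (- a) (- a) = dotv (c *: b) (c *: b).
  rewrite -scaleN1r !dotvZ !dotvZl !mulrA mulrNN mulr1 mul1r -expr2.
  by rewrite sqr_sqrtr ?divfK ?gt_eqF// divr_ge0// ltW.
(* In this case the second reflection would degenerate, and the identity serves instead. *)
have [acb|acb] := eqVneq (- a) (c *: b).
  exists 1%:M; split; first by split; rewrite ?trmx1 ?mulmx1 ?det1.
  exists (- c); first by rewrite oppr_eq0.
  by rewrite mulmx1 scaleNr -acb opprK.
have acb0 : - a - c *: b != 0 by rewrite subr_eq0.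
exists (reflection a *m reflection (- a - c *: b)); split.
  split; first by rewrite trmx_mul mulmxA -(mulmxA (reflection a)) reflectionK// mulmx1 reflectionK.
  rewrite det_mulmx (det_reflection_eq acb0 a0) -[X in _ * X]det_tr -det_mulmx.
  by rewrite reflectionK// det1.
exists c => //; rewrite mulmxA (mul_reflection a a) mulfK ?gt_eqF//.
rewrite (_ : a - 2 *: a = - a) ?reflection_swap//.
by rewrite scaler_nat mulr2n opprD addrA subrr add0r.
Qed.

Definition great_sphere z : set (borel_sphere R d) := [set u | dotv (\val u) z = 0].

Lemma dotv_continuous m (z : 'rV[R]_m) : continuous (fun x : 'rV[R]_m => dotv x z).
Proof.
apply: continuous_big => [|i _]; first exact: add_continuous.
by move=> x; exact: (@cvgM R _ _ _ (fun y : 'rV[R]_m => y 0 i) (fun=> z 0 i) _ _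
  (@coord_continuous _ _ _ _ _ x) (cvg_cst _)).
Qed.

Lemma sphere_open (U : set 'rV[R]_(d + 1)) : open U ->
  open ([set u | U (\val u)] : set (sphere R d)).
Proof. by move=> oU; exists U. Qed.

Lemma measurable_sphere_open (U : set 'rV[R]_(d + 1)) : open U ->
  measurable ([set u | U (\val u)] : set (borel_sphere R d)).
Proof. by move=> oU; apply: sub_sigma_algebra; exact: sphere_open. Qed.

Lemma great_sphere_measurable z : measurable (great_sphere z).
Proof.
rewrite -[great_sphere z]setCK; apply: measurableC.
apply: (@measurable_sphere_open (~` [set x | dotv x z = 0])).
apply: closed_openC.
apply: (@closed_comp _ _ (fun x : 'rV[R]_(d + 1) => dotv x z) [set 0]).
  by move=> x _; exact: dotv_continuous.
exact: closed_eq.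
Qed.

Lemma great_sphereZ (c : R) z : c != 0 -> great_sphere (c *: z) = great_sphere z.
Proof.
move=> c0; apply/seteqP; split=> u; rewrite /great_sphere /= dotvZ.
  by move/eqP; rewrite mulf_eq0 (negbTE c0) => /eqP.
by move=> ->; rewrite mulr0.
Qed.

Lemma rotate_great_sphere Q z : rotation Q ->
  rotate Q (great_sphere z) = great_sphere (z *m Q).
Proof.
move=> [QQ _]; apply/seteqP; split=> u; rewrite /rotate /great_sphere /=.
  by move=> [w wz ->]; rewrite dotv_orthogonal.
move=> uz; have QQ' := mulmx1C QQ.
have wP : \val u *m Q^T \in [set u : 'rV[R]_(d + 1) | unit_vector u].
  rewrite inE /= /unit_vector dotv_orthogonal ?trmxK//.
  by have := set_valP u.
exists (exist (fun x => x \in [set u : 'rV[R]_(d + 1) | unit_vector u]) _ wP) => /=;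
  last by rewrite -mulmxA QQ' mulmx1.
by rewrite -(dotv_orthogonal _ _ QQ) -mulmxA QQ' mulmx1.
Qed.

Variable sigma : {finite_measure set (borel_sphere R d) -> \bar R}.
Hypothesis sigma_rot : rotation_invariant sigma.

Lemma great_sphere_measure_eq a b : a != 0 -> b != 0 ->
  sigma (great_sphere a) = sigma (great_sphere b).
Proof.
move=> a0 b0; have [Q [rQ [c c0 aQ]]] := rotation_onto a0 b0.
rewrite -(sigma_rot.2 Q _ rQ (great_sphere_measurable a)).
by rewrite rotate_great_sphere// aQ great_sphereZ.
Qed.

Definition moment (t : nat) : 'rV[R]_(d + 1) := \row_i t%:R ^+ i.

(** The inner product of [u] with [moment t] is the value at [t] of the nonzero polynomial with
    coefficients [u], of degree at most [d]. *)
Lemma count_moment N (u : borel_sphere R d) :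
  \sum_(t < N) \1_(great_sphere (moment t)) u <= (d + 1)%:R :> R.
Proof.
pose p := rVpoly (\val u).
have hornerp x : p.[x] = \sum_i (\val u) 0 i * x ^+ i.
  by rewrite horner_poly; apply: eq_bigr => i _; rewrite valK.
have rootp (t : nat) : (u \in great_sphere (moment t)) = root p t%:R.
  rewrite rootE hornerp (_ : \sum_i _ = dotv (\val u) (moment t)).
    by apply/idP/eqP; rewrite inE.
  by apply: eq_bigr => i _; rewrite mxE.
have p0 : p != 0.
  apply/eqP => p0; have : unit_vector (\val u) by have := set_valP u.
  rewrite /unit_vector (_ : \val u = 0) /dotv.
    by rewrite big1 => [/eqP|i _]; rewrite ?mxE ?mul0r// eq_sym oner_eq0.
  by rewrite -[LHS]rVpolyK -/p p0 linear0.
pose rs := [seq (t : nat)%:R : R | t <- [seq val t | t <- enum 'I_N] & root p (t : nat)%:R].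
have : (size rs <= d + 1)%N.
  apply: (@leq_trans (size p)); last exact: size_poly.
  apply: ltnW; apply: (max_poly_roots p0).
    by rewrite all_map all_filter; apply/allP => t _; exact/implyP.
  rewrite map_inj_uniq ?filter_uniq//; last by move=> i j /eqP; rewrite eqr_nat => /eqP.
  by rewrite val_enum_ord iota_uniq.
rewrite size_map size_filter count_map -(ler_nat R); apply: le_trans.
rewrite -sum1_count natr_sum [leRHS]big_mkcond /= big_enum /=.
by apply: ler_sum => t _; rewrite indicE rootp; case: ifP.
Qed.

Lemma moment_neq0 t : moment t != 0.
Proof.
have d0 : (0 < d + 1)%N by rewrite addn1.
apply/eqP => /rowP/(_ (Ordinal d0))/eqP.
by rewrite !mxE expr0 oner_eq0.
Qed.

(* At most [d + 1] of the great spheres orthogonal to points of the moment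
   curve meet at a given point, and they all have the same measure. *)
Lemma great_sphere_null z : z != 0 -> sigma (great_sphere z) = 0%E.
Proof.
move=> z0; have fin A : measurable A -> sigma A \is a fin_num.
  by move=> mA; exact: fin_num_measure.
set s := sigma _.
have s_fin : s \is a fin_num by apply: fin; exact: great_sphere_measurable.
pose c := fine (sigma [set: borel_sphere R d]).
have mind (t : nat) : measurable_fun setT
    (fun u => (\1_(great_sphere (moment t)) u : R)%:E).
  apply/measurable_EFinP; apply: measurable_indic.
  exact: great_sphere_measurable.
(* The pointwise count is integrated; the resulting bound does not depend on [N]. *)
have sN N : N%:R * fine s <= (d + 1)%:R * c.
  rewrite -lee_fin !EFinM !fineK//; last exact: fin.
  have -> : ((N%:R)%:E * s = \sum_(t < N) sigma (great_sphere (moment t)))%E.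
    under eq_bigr => t _ do rewrite (great_sphere_measure_eq (moment_neq0 t) z0).
    by rewrite -/s -(fineK s_fin) sumEFin sumr_const card_ord -EFinM mulr_natl.
  under eq_bigr => t _.
    rewrite -[great_sphere _]setIT -integral_indic//; last exact: great_sphere_measurable.
    over.
  rewrite /= -ge0_integral_sum//.
  rewrite -integral_cst//; apply: ge0_le_integral => //.
  - by move=> u _; apply: sume_ge0 => t _; rewrite lee_fin.
  - exact: emeasurable_sum.
  - by move=> u _; rewrite sumEFin lee_fin count_moment.
have s0 : 0 <= fine s by apply: fine_ge0; exact: measure_ge0.
rewrite -(fineK s_fin); congr EFin; apply/eqP; rewrite eq_le s0 andbT leNgt.
apply/negP => s_gt0.
have := sN (Num.bound ((d + 1)%:R * c / fine s)).
rewrite leNgt -ltr_pdivrMr// archi_boundP//.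
by rewrite divr_ge0// mulr_ge0//; apply: fine_ge0; exact: measure_ge0.
Qed.

End great_spheres.

(** * Hyperplanes in homogeneous coordinates *)

Section homogeneous_coordinates.
Variables (R : realType) (n : nat).
Local Notation W := 'rV[R]_(n.+1 + 1).
Implicit Types (H : hyperplane R n) (u z : W).

Lemma normalP H : is_normal (normal H) (sval H).
Proof. exact: projT2 (cid (svalP H)). Qed.

Definition offset H : R := projT1 (cid (normalP H).2).

Lemma offsetP H : sval H = [set x | dotv (normal H) x = offset H].
Proof. exact: projT2 (cid (normalP H).2). Qed.

(* The line of R^(d+1) orthogonal to the embedding of H. *)
Definition hcoord H : W := row_mx (normal H) (- offset H)%:M.

Lemma dotv0 m (x : 'rV[R]_m) : dotv x 0 = 0.
Proof. by rewrite -(scale0r 0) dotvZ mul0r. Qed.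

Lemma dotv_row_mx (a x : 'rV[R]_n.+1) (s t : 'M[R]_1) :
  dotv (row_mx a s) (row_mx x t) = dotv a x + s 0 0 * t 0 0.
Proof.
rewrite /dotv big_split_ord /= big_ord1 !row_mxEr; congr (_ + _).
by apply: eq_bigr => i _; rewrite !row_mxEl.
Qed.

Lemma embed_hcoord H : embed H = orthogonal_complement (hcoord H).
Proof. exact: embed_hyperplane (normalP H).1 (offsetP H). Qed.

Lemma orthogonal_complement_parallel u v : u != 0 -> v != 0 ->
  orthogonal_complement u = orthogonal_complement v ->
  exists2 t : R, t != 0 & v = t *: u.
Proof.
move=> u0 v0 uv; apply: (@normal_parallel _ _ _ _ (orthogonal_complement u)).
  by split => //; exists 0.
by split => //; exists 0; rewrite uv.
Qed.

Lemma hcoord_neq0 H : hcoord H != 0.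
Proof.
apply: contra_neq (normalP H).1 => h0.
by rewrite -[normal H](row_mxKl _ (- offset H)%:M) -/(hcoord H) h0 linear0.
Qed.

Lemma unit_vector_neq0 m (u : 'rV[R]_m) : unit_vector u -> u != 0.
Proof.
move=> u1; rewrite -dotvv_eq0 u1; exact: oner_neq0.
Qed.

(** Scale invariance makes [Q] a property of projective points, and [lsubmx u != 0] excludes the one
    linear hyperplane of R^(d+1) outside the image of [embed]. *)
Lemma cover_preimage_hcoord (Q : W -> Prop) :
  (forall u (c : R), c != 0 -> Q u -> Q (c *: u)) ->
  (forall u, Q u -> lsubmx u != 0) ->
  cover_preimage [set H : hyperplane R n | Q (hcoord H)] = [set u | Q (\val u)].
Proof.
move=> Qscale Q0; apply/seteqP; split=> u /=.
  move=> [H QH]; rewrite embed_hcoord => Hu.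
  have [|t t0 ->] := orthogonal_complement_parallel (hcoord_neq0 H) _ Hu.
    by apply: unit_vector_neq0; have := set_valP u.
  exact: Qscale.
move=> Qu; pose a := lsubmx (\val u); pose c := - (rsubmx (\val u) 0 0).
have a0 : a != 0 := Q0 _ Qu.
have HP : is_hyperplane [set x | dotv a x = c] by exists a; split => //; exists c.
pose H : hyperplane R n := exist _ _ HP.
have HE : embed H = orthogonal_complement (\val u).
  rewrite (@embed_hyperplane _ _ H a c a0 erefl) opprK -mx11_scalar; congr orthogonal_complement.
  exact: hsubmxK.
exists H => //.
have [|t t0 Ht] := orthogonal_complement_parallel _ (hcoord_neq0 H)
    (etrans (esym HE) (embed_hcoord H)).
  by apply: unit_vector_neq0; have := set_valP u.
by rewrite /= Ht; exact: Qscale.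
Qed.

Lemma hyperplane_open_hcoord (Q : W -> Prop) :
  (forall u (c : R), c != 0 -> Q u -> Q (c *: u)) ->
  (forall u, Q u -> lsubmx u != 0) ->
  open [set u | Q u] -> hyperplane_open [set H : hyperplane R n | Q (hcoord H)].
Proof.
move=> Qs Q0 oQ; rewrite /hyperplane_open cover_preimage_hcoord//.
exact: (sphere_open oQ).
Qed.

Lemma embed_inj : injective (@embed R n).
Proof.
move=> H K; rewrite !embed_hcoord => HK.
have [t t0 KH] := orthogonal_complement_parallel (hcoord_neq0 H) (hcoord_neq0 K) HK.
move: KH; rewrite /hcoord scale_row_mx scale_scalar_mx => /eq_row_mx[nK oK].
have {}oK : offset K = t * offset H.
  by move/matrixP/(_ 0 0): oK; rewrite !mxE eqxx !mulr1n mulrN => /oppr_inj.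
have : sval H = sval K.
  rewrite !offsetP nK oK; apply/seteqP; split=> x /=; rewrite dotvZl.
    by move=> ->.
  exact: mulfI.
by case: H K {HK nK oK} => [A hA] [B hB] /= AB; exact: eq_exist.
Qed.

(** The sets with measurable preimage form a sigma-algebra containing the open ones. Complements are
    relative to the image of [embed], whose preimage is therefore treated first, and they rely on
    [embed_inj]. *)
Lemma measurable_cover_preimage (B : set (borel_hyperplane R n)) :
  measurable B -> measurable (cover_preimage B).
Proof.
have mT : measurable (cover_preimage [set: hyperplane R n]).
  rewrite (_ : setT = [set H | lsubmx (hcoord H) != 0]); last first.
    by apply/seteqP; split => H // _; rewrite /= row_mxKl (normalP H).1.
  rewrite (cover_preimage_hcoord (Q := fun u => lsubmx u != 0)) => //.
    apply: (@measurable_sphere_open _ _ [set u : W | lsubmx u != 0]).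
    rewrite (_ : [set u | _] =
        \bigcup_i ((fun u : W => u 0 (lshift 1 i)) @^-1` [set t | t != 0])).
      apply: bigcup_open => i _; apply: open_comp; last exact: open_neq.
      by move=> u _; exact: coord_continuous.
    apply/seteqP; split=> u /=.
      move=> u0; apply: contrapT => ui; case/eqP: u0; apply/rowP => i.
      rewrite !mxE; apply: contrapT => /eqP ui0; apply: ui.
      by exists i.
    by move=> [i _]; apply: contra_neq => /rowP/(_ i); rewrite !mxE.
  by move=> u c c0; rewrite linearZ scaler_eq0 (negbTE c0).
suff : <<s @hyperplane_open R n>> `<=` [set B | measurable (cover_preimage B)] by apply.
apply: smallest_sub; last first.
  by move=> P oP; apply: sub_sigma_algebra.
split => /=.
- rewrite (_ : cover_preimage set0 = set0)//.
  by apply/seteqP; split => u // [].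
- move=> A mA; rewrite setTD.
  rewrite (_ : cover_preimage (~` A) = cover_preimage setT `\` cover_preimage A).
    exact: measurableD.
  apply/seteqP; split=> u /=.
    move=> [H AH Hu]; split; first by exists H.
    by move=> [K AK]; rewrite -Hu => /embed_inj KH; apply: AH; rewrite -KH.
  by move=> [[H _ Hu] nA]; exists H => // AH; apply: nA; exists H.
- move=> F mF; rewrite (_ : cover_preimage _ = \bigcup_k cover_preimage (F k)).
    exact: bigcupT_measurable.
  apply/seteqP; split=> u /=.
    by move=> [H [k _ FH] Hu]; exists k => //; exists H.
  by move=> [k _ [H FH Hu]]; exists H => //; exists k.
Qed.

Definition vert u : R := dotv (lsubmx u) (e_last R n).

Lemma vertZ (c : R) u : vert (c *: u) = c * vert u.
Proof. by rewrite /vert linearZ /= dotvZl. Qed.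

Lemma vert_neq0 u : vert u != 0 -> lsubmx u != 0.
Proof. by apply: contra_neq => u0; rewrite /vert u0 dotvC dotv0. Qed.

Lemma continuous_vert : continuous vert.
Proof.
rewrite (_ : vert = fun u => dotv u (row_mx (e_last R n) 0)).
  exact: dotv_continuous.
apply/funext => u; rewrite -[u in RHS]hsubmxK dotv_row_mx [X in _ * X]mxE mulr0 addr0.
by [].
Qed.

(* The factor [vert] makes the sign independent of the scaling of [hcoord H];
   for [z = (p, 1)] it says on which side of H the point p lies along e_last. *)
Definition pos_side z : set (borel_hyperplane R n) :=
  [set H | 0 < dotv (hcoord H) z * vert (hcoord H)].

Definition slanted : set (borel_hyperplane R n) := [set H | vert (hcoord H) != 0].

Definition on_plane z : set (borel_hyperplane R n) :=
  [set H | vert (hcoord H) != 0 /\ dotv (hcoord H) z = 0].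

(** Shrinks to [on_plane z] as [k] grows; comparison with the norm of [hcoord H] makes it
    independent of scaling. *)
Definition near_plane z (k : nat) : set (borel_hyperplane R n) :=
  [set H | vert (hcoord H) != 0 /\ `|dotv (hcoord H) z| * k.+1%:R <= `|hcoord H|].

Lemma measurable_hyperplane_open (P : set (hyperplane R n)) :
  hyperplane_open P -> measurable (P : set (borel_hyperplane R n)).
Proof. exact: sub_sigma_algebra. Qed.

Lemma measurable_pos_side z : measurable (pos_side z).
Proof.
apply: measurable_hyperplane_open.
apply: (@hyperplane_open_hcoord (fun u => 0 < dotv u z * vert u)).
- move=> u c c0; have c2 : 0 < c * c by rewrite -expr2 exprn_even_gt0.
  by rewrite dotvZl vertZ mulrACA (pmulr_rgt0 _ c2).
- by move=> u uz; apply: vert_neq0; apply: contraTneq uz => ->; rewrite mulr0 ltxx.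
- apply: (@open_comp _ _ (fun u => dotv u z * vert u) [set t | 0 < t]).
    move=> u _; exact: (@cvgM R _ _ _ (fun u : W => dotv u z) vert _ _
      (@dotv_continuous _ _ z u) (@continuous_vert u)).
  exact: open_gt.
Qed.

Lemma measurable_slanted : measurable slanted.
Proof.
apply: measurable_hyperplane_open.
apply: (@hyperplane_open_hcoord (fun u => vert u != 0)).
- by move=> u c c0; rewrite vertZ mulf_eq0 (negbTE c0).
- exact: vert_neq0.
- apply: (@open_comp _ _ vert [set t | t != 0]).
    by move=> u _; exact: continuous_vert.
  exact: open_neq.
Qed.

Lemma measurable_near_plane z k : measurable (near_plane z k).
Proof.
rewrite (_ : near_plane z k = slanted `\`
    [set H | vert (hcoord H) != 0 /\ `|hcoord H| < `|dotv (hcoord H) z| * k.+1%:R]).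
  apply: measurableD; first exact: measurable_slanted.
  apply: measurable_hyperplane_open.
  apply: (@hyperplane_open_hcoord (fun u => vert u != 0 /\ `|u| < `|dotv u z| * k.+1%:R)).
  - move=> u c c0 [u0 uz]; split; first by rewrite vertZ mulf_neq0.
    by rewrite dotvZl normrZ normrM -mulrA ltr_pM2l// normr_gt0.
  - by move=> u [/vert_neq0].
  - rewrite (_ : [set u | _] = vert @^-1` [set t | t != 0] `&`
        (fun u : W => `|dotv u z| * k.+1%:R - `|u|) @^-1` [set t | 0 < t]).
      apply: openI; apply: open_comp; [|exact: open_neq| |exact: open_gt].
        by move=> u _; exact: continuous_vert.
      move=> u _.
      have c1 : `|dotv y z| @[y --> u] --> `|dotv u z|.
        exact: (cvg_norm (@dotv_continuous _ _ z u)).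
      have c2 : (`|dotv y z| * k.+1%:R) @[y --> u] --> `|dotv u z| * k.+1%:R.
        exact: (cvgM c1 (cvg_cst _)).
      exact: (cvgB c2 (@norm_continuous _ _ u)).
    by apply/seteqP; split=> u /=; rewrite subr_gt0.
apply/seteqP; split => H; rewrite /near_plane /slanted /=.
  by move=> [v0 h]; split => // -[_]; rewrite ltNge h.
by move=> [v0 h]; split => //; rewrite leNgt; apply/negP => h'; apply: h.
Qed.

Lemma measurable_on_plane z : measurable (on_plane z).
Proof.
rewrite (_ : on_plane z = (slanted `\` pos_side z) `\` pos_side (- z)).
  apply: measurableD; last exact: measurable_pos_side.
  by apply: measurableD; [exact: measurable_slanted|exact: measurable_pos_side].
apply/seteqP; split => H; rewrite /on_plane /slanted /pos_side /=.
  by rewrite dotvN => -[v0 ->]; rewrite oppr0 mul0r ltxx.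
rewrite dotvN mulNr oppr_gt0 => -[[v0 /negP h1] /negP h2]; split => //.
apply/eqP; rewrite -(mulIr_eq0 _ (mulIf v0)).
by move: h1 h2; rewrite -!leNgt => h1 h2; rewrite eq_le h1 h2.
Qed.

End homogeneous_coordinates.

(** * Null boundaries and continuity of the measure of a side *)

Section side_measures.
Variables (R : realType) (n : nat).
Local Notation W := 'rV[R]_(n.+1 + 1).
Implicit Types (H : hyperplane R n) (u z : W).
Variable mu : {finite_measure set (borel_hyperplane R n) -> \bar R}.
Hypothesis mu_ac : absolutely_continuous mu.

(** The hyperplanes concerned pull back into the great sphere orthogonal to [z]. *)
Lemma on_plane_null z : z != 0 -> mu (on_plane z) = 0%E.
Proof.
move=> z0; have [sigma [sigma_rot dom]] := mu_ac.
apply: (dom (on_plane z)) => //; last exact: measurable_on_plane.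
move=> B mB Bz; apply/eqP; rewrite -measure_le0 -(great_sphere_null sigma_rot z0).
apply: le_measure; rewrite ?inE.
- exact: measurable_cover_preimage.
- exact: great_sphere_measurable.
move=> u [H /Bz[_ Hz]]; rewrite embed_hcoord => Hu; rewrite /great_sphere /=.
have [|t _ ->] := orthogonal_complement_parallel (hcoord_neq0 H) _ Hu.
  by apply: unit_vector_neq0; have := set_valP u.
by rewrite dotvZl Hz mulr0.
Qed.

Lemma bigcap_near_plane z : \bigcap_k near_plane z k = on_plane z.
Proof.
apply/seteqP; split => H /=.
  move=> Hz; split; first by have [] := Hz 0%N I.
  apply/eqP; rewrite -normr_eq0 eq_le normr_ge0 andbT leNgt; apply/negP => h0.
  have [_] := Hz (Num.bound (`|hcoord H| / `|dotv (hcoord H) z|)) I.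
  rewrite leNgt mulrC -ltr_pdivrMr// => /negP; apply.
  rewrite (lt_le_trans (archi_boundP _)) ?divr_ge0//.
  by rewrite ler_nat.
by move=> [v0 Hz] k _; split => //; rewrite Hz normr0 mul0r.
Qed.

Lemma near_plane_cvg0 z : z != 0 ->
  fine (mu (near_plane z k)) @[k --> \oo] --> (0 : R).
Proof.
move=> z0; apply: fine_cvg.
rewrite [X in _ --> X](_ : _ = mu (\bigcap_k near_plane z k)); last first.
  by rewrite bigcap_near_plane on_plane_null.
apply: nonincreasing_cvg_mu.
- by rewrite ltey_eq fin_num_measure//; exact: measurable_near_plane.
- by move=> k; exact: measurable_near_plane.
- by rewrite bigcap_near_plane; exact: measurable_on_plane.
move=> j k jk; apply/subsetPset => H [v0 Hk]; split => //.
by apply: le_trans Hk; rewrite ler_wpM2l// ler_nat.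
Qed.

Lemma fine_measure_le_setU (A B C : set (borel_hyperplane R n)) :
  measurable A -> measurable B -> measurable C -> A `<=` B `|` C ->
  fine (mu A) <= fine (mu B) + fine (mu C).
Proof.
move=> mA mB mC ABC; rewrite -lee_fin EFinD !fineK ?fin_num_measure//.
apply: le_trans (measureU2 _ mB mC).
by apply: le_measure; rewrite ?inE//; exact: measurableU.
Qed.

Lemma dotv_norm_le m (x y : 'rV[R]_m) : `|dotv x y| <= m%:R * (`|x| * `|y|).
Proof.
rewrite (le_trans (ler_norm_sum _ _ _))// mulr_natl -[X in _ *+ X]card_ord.
rewrite -sumr_const; apply: ler_sum => i _.
by rewrite normrM ler_pM// rV_norm_ge.
Qed.

(** Off [near_plane z k] the product with [z] exceeds any change caused by so small a move, so its
    sign persists; the factor [n.+1 + 1] in the radius is the constant of [dotv_norm_le]. *)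
Lemma pos_side_perturb H z y k :
  `|z - y| < ((n.+1 + 1)%:R * k.+1%:R)^-1 -> ~ near_plane z k H ->
  pos_side z H <-> pos_side y H.
Proof.
move=> zy Hz; rewrite /pos_side /=.
have [v0|v0] := eqVneq (vert (hcoord H)) 0; first by rewrite v0 !mulr0.
set h := hcoord H in v0 Hz *.
have {}Hz : `|h| < `|dotv h z| * k.+1%:R.
  by rewrite ltNge; apply/negP => Hz'; apply: Hz.
have h0 : 0 < `|h| by rewrite normr_gt0 hcoord_neq0.
have hzy : `|dotv h z - dotv h y| < `|dotv h z|.
  rewrite -dotvN -dotvD (le_lt_trans (dotv_norm_le _ _))//.
  rewrite -(ltr_pM2r (ltr0Sn R k)); apply: le_lt_trans Hz.
  have {}zy : `|z - y| * ((n.+1 + 1)%:R * k.+1%:R) <= 1.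
    by rewrite -ler_pdivlMr ?mul1r ?ltW// mulr_gt0// ltr0n addn1.
  rewrite [leLHS](_ : _ = `|h| * (`|z - y| * ((n.+1 + 1)%:R * k.+1%:R))); last ring.
  by rewrite ler_piMr// ltW.
(* With a and b the two products, squaring [|a - b| < |a|] gives [b ^+ 2 < 2 * a * b]. *)
have ab : 0 < dotv h z * dotv h y.
  move: hzy; rewrite -ltr_sqr ?nnegrE// !real_normK ?num_real//.
  by have := sqr_ge0 (dotv h y); nra.
have : 0 < (dotv h z * vert h) * (dotv h y * vert h).
  by rewrite mulrACA -expr2 mulr_gt0// exprn_even_gt0.
by split => hv; [rewrite -(pmulr_rgt0 _ hv)|rewrite -(pmulr_lgt0 _ hv)].
Qed.

(** The sides of [z] and of a nearby [y] differ only within [near_plane z k], of measure at most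
    [eps]. *)
Lemma pos_side_continuous z : z != 0 ->
  {for z, continuous (fun y => fine (mu (pos_side y)))}.
Proof.
move=> z0; apply/(@cvgrPdist_le _ _ _ (nbhs z)) => eps eps0.
have [k Hk] : exists k, fine (mu (near_plane z k)) <= eps.
  have /cvgrPdist_le/(_ _ eps0)[k _ /(_ k)] := near_plane_cvg0 z0.
  rewrite /= leqnn sub0r normrN => /(_ isT) h; exists k.
  exact: le_trans (ler_norm _) h.
have d0 : 0 < ((n.+1 + 1)%:R * k.+1%:R)^-1 :> R.
  by rewrite invr_gt0 mulr_gt0// ltr0n addn1.
apply/nbhs_ballP; exists ((n.+1 + 1)%:R * k.+1%:R)^-1 => // y.
rewrite -ball_normE /= => zy.
have mN := measurable_near_plane z k.
have mz := measurable_pos_side z; have my := measurable_pos_side y.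
rewrite ler_distlC; apply/andP; split.
- rewrite lerBlDr (le_trans (fine_measure_le_setU mz my mN _))// ?lerD2l//.
  move=> H Hz; have [?|Hn] := pselect (near_plane z k H); [by right|left].
  exact/(pos_side_perturb zy Hn).
- rewrite (le_trans (fine_measure_le_setU my mz mN _))// ?lerD2l//.
  move=> H Hy; have [?|Hn] := pselect (near_plane z k H); [by right|left].
  exact/(pos_side_perturb zy Hn).
Qed.

(** Vertical hyperplanes would satisfy the inequality as [0 <= 0], hence the explicit exclusion. *)
Definition closed_side z : set (borel_hyperplane R n) :=
  [set H | vert (hcoord H) != 0 /\ 0 <= dotv (hcoord H) z * vert (hcoord H)].

Lemma closed_sideE z : closed_side z = pos_side z `|` on_plane z.
Proof.
apply/seteqP; split => H; rewrite /closed_side /pos_side /on_plane /=.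
  move=> [v0]; rewrite le_eqVlt => /orP[|]; last by left.
  by rewrite eq_sym (mulIr_eq0 _ (mulIf v0)) => /eqP; right.
move=> [Hz|[v0 ->]]; last by rewrite mul0r.
by split; [apply: contraTneq Hz => ->; rewrite mulr0 ltxx|exact: ltW].
Qed.

Lemma measurable_closed_side z : measurable (closed_side z).
Proof.
rewrite closed_sideE; apply: measurableU; first exact: measurable_pos_side.
exact: measurable_on_plane.
Qed.

Lemma measure_closed_side z : z != 0 -> mu (closed_side z) = mu (pos_side z).
Proof.
move=> z0; rewrite closed_sideE measureU0//; last exact: on_plane_null.
  exact: measurable_pos_side.
exact: measurable_on_plane.
Qed.

End side_measures.

(** * Half-lines and vertical speeds in terms of sides *)

Section sides.
Variables (R : realType) (n : nat).
Local Notation W := 'rV[R]_(n.+1 + 1).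
Local Notation e := (e_last R n).
Implicit Types (H : hyperplane R n) (u z : W) (p v : 'rV[R]_n.+1).

Lemma dotv_e_last : dotv e e = 1.
Proof.
rewrite /dotv (bigD1 ord_max)//= !mxE !eqxx mulr1 big1 ?addr0// => i.
by rewrite /e_last !mxE => /negbTE ->; rewrite andbF mul0r.
Qed.

Lemma vert_hcoord H : vert (hcoord H) = dotv (normal H) e.
Proof. by rewrite /vert row_mxKl. Qed.

(** If [H] meets the line at [p + t *: (s *: e)], the product that defines the side is
    [t * (s * dotv (normal H) e) ^+ 2], with the sign of [t]. *)
Lemma half_line_side p (s : R) : s != 0 ->
  [set H : hyperplane R n | exists x, sval H `&` line p e = [set x] /\ half_line p (s *: e) x]
  = closed_side (- s *: row_mx p 1%:M).
Proof.
move=> s0; apply/seteqP; split => H; rewrite /closed_side /= vert_hcoord.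
  move=> [x [Hx [t t0 xE]]].
  have [Hx1 _] : (sval H `&` line p e) x by rewrite Hx.
  rewrite offsetP /= in Hx1.
  split.
    (* A vertical [H] through [x] contains [x + e] as well, so the intersection is no single
       point. *)
    apply/eqP => v0; have : (sval H `&` line p e) (x + e).
      split; first by rewrite offsetP /= dotvD Hx1 v0 addr0.
      by exists (t * s + 1) => //; rewrite scalerDl scale1r addrA -xE scalerA.
    rewrite Hx /= => /eqP; rewrite -subr_eq0 addrAC subrr add0r => /eqP e0.
    by have := dotv_e_last; rewrite e0 dotv0 => /eqP; rewrite eq_sym oner_eq0.
  rewrite dotvZ dotv_row_mx !mxE eqxx !mulr1n mulr1 -Hx1 -xE dotvD !dotvZ.
  rewrite (_ : _ * _ = t * (s * dotv (normal H) e) ^+ 2); last ring.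
  by rewrite mulr_ge0// sqr_ge0.
move=> [v0]; rewrite dotvZ dotv_row_mx !mxE eqxx !mulr1n mulr1.
set v := dotv _ e in v0 *; set c := offset H => h.
pose t := (c - dotv (normal H) p) / v.
exists (p + t *: e); split; last first.
  exists (t / s); last by rewrite scalerA divfK.
  rewrite /= /t (_ : _ / _ = (- s * (dotv (normal H) p - c) * v) / (s * v) ^+ 2).
    by rewrite divr_ge0// sqr_ge0.
  by field; rewrite s0 v0.
apply/seteqP; split => x /=.
  move=> [hx [t' _ xE]]; move: hx; rewrite -xE offsetP /= dotvD dotvZ -/v -/c => hc.
  by rewrite /t -hc addrAC subrr add0r mulfK.
move=> ->; split; last by exists t.
by rewrite offsetP /= dotvD dotvZ -/v -/c /t divfK// addrC subrK.
Qed.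

(** The product of the normal with [v + m *: e] is [m - vertical_speed H v] times its vertical
    component; so points with last coordinate 0 compare speeds. *)
Lemma dotv_hcoord_speed H v (m r : R) : has_vertical_speed H ->
  dotv (hcoord H) (r *: row_mx (v + m *: e) 0) * vert (hcoord H) =
  r * vert (hcoord H) ^+ 2 * (m - vertical_speed H v).
Proof.
rewrite /has_vertical_speed /vertical_speed vert_hcoord => v0.
have Z0 : (0 : 'M[R]_1) 0 0 = 0 by rewrite mxE.
by rewrite dotvZ dotv_row_mx Z0 mulr0 addr0 dotvD dotvZ; field.
Qed.

Lemma vertical_speed_sides v (m r : R) : 0 < r ->
  let z := r *: row_mx (v + m *: e) 0 in
  [set H | has_vertical_speed H /\ vertical_speed H v <= m] = closed_side z /\
  [set H | has_vertical_speed H /\ m <= vertical_speed H v] = closed_side (- z).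
Proof.
move=> r0 z.
have pos H : has_vertical_speed H -> 0 < r * vert (hcoord H) ^+ 2.
  by rewrite vert_hcoord => h; rewrite mulr_gt0// exprn_even_gt0.
have hE H : has_vertical_speed H = (vert (hcoord H) != 0).
  by rewrite vert_hcoord.
split; apply/seteqP; split => H; rewrite /closed_side /= -hE => -[hH];
  rewrite ?dotvN ?mulNr dotv_hcoord_speed// -?mulrN pmulr_rge0 ?pos//;
  by rewrite ?opprB subr_ge0.
Qed.

Lemma closed_sideZ (c : R) z : 0 < c -> closed_side (c *: z) = closed_side z.
Proof.
move=> c0; apply/seteqP; split => H; rewrite /closed_side /= dotvZ -mulrA.
  by rewrite pmulr_rge0.
by move=> [v0 h]; rewrite pmulr_rge0.
Qed.

(** Emptiness of the opposite side leaves all slanted hyperplanes in [closed_side z]. *)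
Lemma closed_side_slanted x z : closed_side (- z) = set0 ->
  closed_side x `<=` @closed_side R n z.
Proof.
move=> z0 H [v0 _]; split => //; have [//|h] := leP 0 (dotv (hcoord H) z * vert (hcoord H)).
suff : set0 H by [].
by rewrite -z0 /closed_side /= dotvN mulNr oppr_ge0 ltW.
Qed.

End sides.

(** * The common zero of the odd maps and its three cases *)

Theorem theorem5p2 (R : realType) (n : nat)
    (mu : 'I_n.+1 -> {finite_measure set (borel_hyperplane R n) -> \bar R})
    (mu_ac : forall i, absolutely_continuous (mu i)) :
  (exists v : 'rV[R]_n.+1,
     [/\ unit_vector v, dotv v (e_last R n) = 0 &
         exists m : R, forall i, is_median_speed (mu i) v m])
  \/
  (exists a p : 'rV[R]_n.+1,
     let l := line a (e_last R n) in
     l p /\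
     forall i, line_measure (mu i) l (half_line p (e_last R n)) =
               line_measure (mu i) l (half_line p (- e_last R n))).
Proof.
pose G i z := fine (mu i (pos_side z)) - fine (mu i (pos_side (- z))).
have [|||z z0 Gz] := @borsuk_ulam R (n.+1 + 1) n.+1 G.
- by rewrite addn1.
- by move=> i z; rewrite /G opprK opprB.
- move=> i z z0; have zN : - z != 0 by rewrite oppr_eq0.
  have c1 := pos_side_continuous (mu_ac i) z0.
  have c2 : {for z, continuous (fun y : 'rV[R]_(n.+1 + 1) => fine (mu i (pos_side (- y))))}.
    apply: (@continuous_comp _ _ _ (@GRing.opp 'rV[R]_(n.+1 + 1))
      (fun y : 'rV[R]_(n.+1 + 1) => fine (mu i (pos_side y)))).
      exact: opp_continuous.
    exact: pos_side_continuous.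
  exact: (cvgB c1 c2).
have {}Gz i : mu i (pos_side z) = mu i (pos_side (- z)).
  have mfin y : mu i (pos_side y) \is a fin_num.
    by apply: fin_num_measure; exact: measurable_pos_side.
  rewrite -(fineK (mfin z)) -(fineK (mfin (- z))); congr EFin.
  by apply/eqP; rewrite -subr_eq0 -/(G i z) Gz.
have side_eq i : mu i (closed_side z) = mu i (closed_side (- z)).
  by rewrite !measure_closed_side ?oppr_eq0.
pose y := lsubmx z; pose s := rsubmx z 0 0.
have zE : z = row_mx y s%:M by rewrite -mx11_scalar hsubmxK.
have line_pp p : line p (e_last R n) p by exists 0 => //; rewrite scale0r addr0.
have line_sides p (q : R) : q != 0 -> forall i,
    line_measure (mu i) (line p (e_last R n)) (half_line p (q *: e_last R n)) =
    mu i (closed_side (- q *: row_mx p 1%:M)).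
  by move=> q0 i; rewrite -half_line_side.
(* For [s != 0] the zero represents the point [s^-1 *: y] of R^d; a negative [s] merely swaps the
   two half-lines. *)
have [s0|s0] := eqVneq s 0; last first.
  right; exists (s^-1 *: y), (s^-1 *: y); split => // i.
  have := line_sides (s^-1 *: y) 1 (oner_neq0 _) i; rewrite scale1r => ->.
  have := line_sides (s^-1 *: y) (-1) _ i; rewrite scaleN1r => ->; last first.
    by rewrite oppr_eq0 oner_neq0.
  rewrite opprK scale1r scaleN1r.
  have -> : row_mx (s^-1 *: y) 1%:M = s^-1 *: z.
    by rewrite zE scale_row_mx scale_scalar_mx mulVf.
  have [s_gt0|s_lt0] := ltP 0 s.
    by rewrite -scalerN !closed_sideZ ?invr_gt0// side_eq.
  have {}s_lt0 : 0 < - s^-1 by rewrite oppr_gt0 invr_lt0 lt_neqAle s0.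
  rewrite -scaleNr (_ : s^-1 *: z = - s^-1 *: - z) ?closed_sideZ//.
  by rewrite scaleNr scalerN opprK.
pose tt := dotv y (e_last R n); pose w := y - tt *: e_last R n.
have we : dotv w (e_last R n) = 0.
  by rewrite dotvC dotvD dotvN dotvZ dotv_e_last mulr1 dotvC subrr.
(* If [w = 0], then [z] is a multiple of [row_mx (e_last R n) 0]: all slanted hyperplanes lie on one
   side, the balance forces their measure to be 0, and any point will do. *)
have [w0|w0] := eqVneq w 0.
  right; exists 0, 0; split => // i.
  have hz H : dotv (hcoord H) z * vert (hcoord H) = tt * vert (hcoord H) ^+ 2.
    rewrite zE s0 (_ : y = tt *: e_last R n); last by apply/eqP; rewrite -subr_eq0 -/w w0.
    rewrite dotv_row_mx (_ : 0%:M 0 0 = 0) ?mulr0 ?addr0; last by rewrite !mxE mul0rn.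
    by rewrite dotvZ vert_hcoord; ring.
  have tt0 : tt != 0.
    apply: contra_neq z0 => t0; rewrite zE s0 (_ : y = 0).
      by rewrite (_ : 0%:M = 0) ?row_mx0//; apply/matrixP => j k; rewrite !mxE mul0rn.
    by rewrite -[LHS](subrK (tt *: e_last R n)) -/w w0 t0 scale0r addr0.
  have null0 z' x : mu i (closed_side z') = mu i (closed_side (- z')) ->
      closed_side (- z') = set0 -> mu i (closed_side x) = 0%E.
    move=> z'E e0; apply/eqP; rewrite -measure_le0.
    rewrite (_ : 0%E = mu i (closed_side z')); last by rewrite z'E e0 measure0.
    apply: le_measure; rewrite ?inE.
    - exact: measurable_closed_side.
    - exact: measurable_closed_side.
    exact: closed_side_slanted.
  have null x : mu i (closed_side x) = 0%E.
    have [t_gt0|t_le0] := ltP 0 tt.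
      apply: (null0 z) => //; apply/seteqP; split => // H.
      rewrite /closed_side /= dotvN mulNr hz oppr_ge0 => -[v0].
      by rewrite leNgt mulr_gt0// exprn_even_gt0.
    apply: (null0 (- z)); rewrite opprK//; apply/seteqP; split => // H.
    rewrite /closed_side /= hz => -[v0]; rewrite leNgt => /negP; apply.
    by rewrite nmulr_rlt0 ?exprn_even_gt0// lt_neqAle tt0.
  have := line_sides 0 1 (oner_neq0 _) i; rewrite scale1r => ->.
  have := line_sides 0 (-1) _ i; rewrite scaleN1r => ->; last first.
    by rewrite oppr_eq0 oner_neq0.
  by rewrite !null.
(* Normalising [w] divides the speed by [r] too: [z] is [r] times the row with first block
   [r^-1 *: w + (tt / r) *: e_last R n] and last entry 0. *)
left; pose r := Num.sqrt (dotv w w).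
have ww := dotvv_gt0 w0.
have r0 : 0 < r by rewrite sqrtr_gt0.
exists (r^-1 *: w); split.
- rewrite /unit_vector dotvZ dotvZl mulrA -invfM -expr2 sqr_sqrtr ?ltW//.
  by rewrite mulVf ?gt_eqF.
- by rewrite dotvZl we mulr0.
exists (tt / r) => i; rewrite /is_median_speed.
have [-> ->] := vertical_speed_sides (r^-1 *: w) (tt / r) r0.
rewrite (_ : r *: _ = z) ?side_eq//.
rewrite zE s0 scale_row_mx scaler0 scalerDr !scalerA divff ?gt_eqF// scale1r.
rewrite mulrCA divff ?gt_eqF// mulr1 subrK; congr row_mx.
by apply/matrixP => j k; rewrite !mxE mul0rn.
Qed.
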